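(* Consider the energy sharing game with $N\ge 2$ prosumers, price sensitivity $a<0$, and parameters $c_i>0$, $d_i>0$, $D_i\in\mathbb{R}$ ($i\in\mathcal{I}=\{1,\dots,N\}$), as defined in the context, and let $(p^*,b^* )$ be its Nash equilibrium. Then: (1) the sharing price at equilibrium, $\lambda_c^*=\lambda_c(b^* )$, is given by $\lambda_c^*=\frac1N\sum_{i=1}^N md_i(p_i^* )$; (2) for every $i\in\mathcal{I}$, $md_i(p_i^* )>\lambda_c(b^* )$ if and only if $q_i(b^* )>0$.
   Context: Energy sharing game. The players (prosumers) are $\mathcal{I}=\{1,\dots,N\}$. Prosumer $i$ has a required load reduction $D_i\in\mathbb{R}$ and disutility function $f_i(p_i)=c_ip_i^2+d_ip_i$ with $c_i,d_i>0$. The marginal disutility of prosumer $i$ is $md_i(p_i):=f_i'(p_i)=2c_ip_i+d_i$. The common price sensitivity is $a<0$. Each prosumer $i$ chooses an output adjustment $p_i\in\mathbb{R}$ and a bid $b_i\in\mathbb{R}$. Given the bids $b=(b_1,\dots,b_N)$, the sharing price is $\lambda_c(b)=-\frac{1}{Na}\sum_{j=1}^N b_j$ (equivalently, the market clears: $\sum_i(a\lambda_c+b_i)=0$), and prosumer $i$ buys the quantity $q_i(b)=a\lambda_c(b)+b_i$ (sells if negative). Given the other bids $b_{-i}$, prosumer $i$ minimizes $$\Pi_i(p_i,b_i,b_{-i})=c_ip_i^2+d_ip_i+(a\lambda_c(b)+b_i)\lambda_c(b)$$ over the action set $X_i(b_{-i})=\{(p_i,b_i)\in\mathbb{R}^2:\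 p_i+a\lambda_c(b)+b_i=D_i\}$. A profile $(p^*,b^* )$ is a Nash equilibrium if for every $i$, $(p_i^*,b_i^* )\in X_i(b_{-i}^* )$ and $\Pi_i(p_i^*,b_i^*,b_{-i}^* )\le\Pi_i(p_i,b_i,b_{-i}^* )$ for all $(p_i,b_i)\in X_i(b_{-i}^* )$. *)

(* Defs.v *)
From HB Require Import structures.
From mathcomp Require Import all_boot all_order all_algebra.
From mathcomp Require Import all_classical all_reals all_analysis.
From mathcomp Require Import ring.

Set Implicit Arguments.
Unset Strict Implicit.
Unset Printing Implicit Defensive.

Import Order.TTheory GRing.Theory Num.Theory.
Import numFieldNormedType.Exports.

Local Open Scope classical_set_scope.
Local Open Scope ring_scope.

(* Prosumers are numbered from 0: they are the elements of 'I_N. *)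
Section EnergySharing.
Variables (R : realType) (N : nat).

Definition disutility (ci di : R) : R -> R := fun x => ci * x ^+ 2 + di * x.

Definition marginal_disutility (ci di : R) : R -> R :=
  derive1 (disutility ci di).

Lemma marginal_disutilityE (ci di x : R) :
  marginal_disutility ci di x = 2 * ci * x + di.
Proof.
have Hx : is_derive x 1 (fun y : R => y ^+ 2) (2 * x).
  apply: DeriveDef; first exact: exprn_derivable.
  by rewrite exp_derive expr1 /GRing.scale /= mulr1.
have H : is_derive x 1 (disutility ci di) (ci *: (2 * x) + di *: (1 : R)).
  by apply: is_deriveD; apply: is_deriveZ.
by rewrite /marginal_disutility derive1E derive_val /GRing.scale /=; ring.
Qed.

Definition sharing_price (a : R) (b : 'I_N -> R) : R :=
  - (1 / (N%:R * a)) * \sum_(j < N) b j.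

Definition purchase (a : R) (b : 'I_N -> R) (i : 'I_N) : R :=
  a * sharing_price a b + b i.

(* In sharing_cost and action_set the rivals' bids b_{-i} are passed as a full
   profile b; its i-th entry is overwritten by prosumer i's own bid, so it is
   irrelevant. *)
Definition set_bid (b : 'I_N -> R) (i : 'I_N) (bi : R) : 'I_N -> R :=
  [eta b with i |-> bi].

Definition sharing_cost (a : R) (c d : 'I_N -> R) (i : 'I_N)
    (xi bi : R) (b : 'I_N -> R) : R :=
  let b' := set_bid b i bi in
  disutility (c i) (d i) xi + purchase a b' i * sharing_price a b'.

Definition action_set (a : R) (D : 'I_N -> R) (i : 'I_N) (b : 'I_N -> R) :
    set (R * R) :=
  [set s | s.1 + a * sharing_price a (set_bid b i s.2) + s.2 = D i].

Definition nash_equilibrium (a : R) (c d D : 'I_N -> R)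
    (p b : 'I_N -> R) : Prop :=
  forall i : 'I_N,
    action_set a D i b (p i, b i) /\
    (forall xi bi : R, action_set a D i b (xi, bi) ->
       sharing_cost a c d i (p i) (b i) b <= sharing_cost a c d i xi bi b).

End EnergySharing.

(* Main.v *)
Require Import Defs.
From mathcomp Require Import all_boot all_order all_algebra.
From mathcomp Require Import all_classical all_reals all_analysis.
From mathcomp Require Import ring lra.

Import Order.TTheory GRing.Theory Num.Theory.
Local Open Scope ring_scope.

(** Against fixed rival bids, prosumer [i] controls a single parameter: the
    amount [s] by which the price moves. The bid that moves it by [s] is
    [b i - N a s], which changes the purchase by [- (N - 1) a s] and hence,
    by the balance constraint, the output by [(N - 1) a s]. Along this line the
    cost is a quadratic polynomial in [s], minimal at [s = 0], so its linear
    coefficient vanishes ([nash_first_order]): writing [m] for the marginal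
    disutility, [q] for the purchase and [l] for the price,
      [q = - (N - 1) a (m - l)].
    Since [- (N - 1) a > 0], [q] and [m - l] have the same sign, which is the
    second claim. Summing over the prosumers, the purchases cancel by market
    clearing ([sum_purchase]), so the [m - l] sum to zero, which is the first
    claim. *)

Lemma linear_coef_eq0 (R : realFieldType) (A B : R) :
  (forall s, 0 <= A * s ^+ 2 + B * s) -> B = 0.
Proof.
move=> H; apply/eqP; rewrite -sqrf_eq0 eq_le sqr_ge0 andbT.
(* Any [k > max (A, 0)] makes the step [- B / k] strictly profitable unless
   [B = 0]. *)
pose k := `|A| + 1.
have k0 : 0 < k by rewrite ltr_wpDl.
have Ak : A - k <= -1 by rewrite /k; have := ler_norm A; lra.
have := H (- B / k).
have -> : A * (- B / k) ^+ 2 + B * (- B / k) = (A - k) * B ^+ 2 / k ^+ 2.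
  by field; rewrite gt_eqF.
rewrite pmulr_lge0 ?invr_gt0 ?exprn_gt0 // => H1.
have := sqr_ge0 B; nra.
Qed.

Section Game.
Variables (R : realType) (N : nat) (a : R).
Hypotheses (hN : (2 <= N)%N) (ha : a < 0).

Let N0 : N%:R != 0 :> R.
Proof. by rewrite pnatr_eq0; case: N hN. Qed.

Let a0 : a != 0.
Proof. by rewrite lt_eqF. Qed.

Lemma sum_purchase (b : 'I_N -> R) : \sum_(i < N) purchase a b i = 0.
Proof.
rewrite big_split /= sumr_const card_ord /sharing_price -mulr_natl.
by field; rewrite N0 a0.
Qed.

Lemma sharing_price_set_bid (b : 'I_N -> R) i x :
  sharing_price a (set_bid b i x) = sharing_price a b - (x - b i) / (N%:R * a).
Proof.
rewrite /sharing_price /set_bid (bigD1 i) //= [in RHS](bigD1 i) //= eqxx.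
under eq_bigr => j /negPf ji do rewrite ji.
by field; rewrite N0 a0.
Qed.

Lemma sharing_price_shift (b : 'I_N -> R) i s :
  sharing_price a (set_bid b i (b i - N%:R * a * s)) = sharing_price a b + s.
Proof. by rewrite sharing_price_set_bid; field; rewrite N0 a0. Qed.

Lemma sharing_price_set_bid_id (b : 'I_N -> R) i :
  sharing_price a (set_bid b i (b i)) = sharing_price a b.
Proof. by rewrite sharing_price_set_bid subrr mul0r subr0. Qed.

(** The first-order condition of prosumer [i]: the linear coefficient of the
    cost in the price deviation [s] is
    [m (N - 1) a + q - (N - 1) a l]. *)
Lemma nash_first_order (c d D p b : 'I_N -> R) i :
  nash_equilibrium a c d D p b ->
  purchase a b i = - ((N%:R - 1) * a) *
    (marginal_disutility (c i) (d i) (p i) - sharing_price a b).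
Proof.
move=> /(_ i)[]; rewrite /action_set /= sharing_price_set_bid_id => hD hmin.
rewrite marginal_disutilityE; apply/eqP; rewrite -subr_eq0; apply/eqP.
pose k := (N%:R - 1) * a.
apply: (@linear_coef_eq0 _ (c i * k ^+ 2 - k)) => s.
have := hmin (p i + k * s) (b i - N%:R * a * s).
rewrite /sharing_cost /purchase /disutility sharing_price_shift.
rewrite sharing_price_set_bid_id /set_bid /= !eqxx => /(_ _); rewrite -subr_ge0.
have feasible : p i + k * s + a * (sharing_price a b + s)
    + (b i - N%:R * a * s) = D i by rewrite -hD /k; ring.
by move=> /(_ feasible); congr (0 <= _); rewrite /k; ring.
Qed.

End Game.

Theorem proposition3 (R : realType) (N : nat) (a : R) (c d D : 'I_N -> R)
    (p b : 'I_N -> R) (hN : (2 <= N)%N) (ha : a < 0)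
    (hc : forall i, 0 < c i) (hd : forall i, 0 < d i)
    (hNE : nash_equilibrium a c d D p b) :
  sharing_price a b
    = 1 / N%:R * \sum_(i < N) marginal_disutility (c i) (d i) (p i)
  /\ (forall i : 'I_N,
        marginal_disutility (c i) (d i) (p i) > sharing_price a b
        <-> purchase a b i > 0).
Proof.
have foc i := nash_first_order _ _ _ hN ha _ _ _ _ _ i hNE.
have k0 : 0 < - ((N%:R - 1) * a).
  by rewrite -mulrN mulr_gt0 ?oppr_gt0 // subr_gt0 ltr1n.
split; last by move=> i; rewrite foc pmulr_rgt0 // subr_gt0.
have := sum_purchase _ _ _ hN ha b.
under eq_bigr do rewrite foc.
rewrite -mulr_sumr => /eqP; rewrite mulf_eq0 gt_eqF //= sumrB subr_eq0.
move=> /eqP ->; rewrite sumr_const card_ord.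
by field; rewrite pnatr_eq0 -lt0n ltnW.
Qed.
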